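(* Let $n$ be any positive integer. For every integer $t\ge 3$, $n$ is a cube sum over the imaginary quadratic field $K_{n,t}=\mathbb{Q}\big(\sqrt{-3(4nt^3-27)}\big)$.
   Context: A positive integer $n$ is called a cube sum over a number field $F$ if $n=x^3+y^3$ for some $x,y\in F$. *)

(* Defs.v *)
From HB Require Import structures.
From mathcomp Require Import all_boot all_order all_algebra all_field.

Set Implicit Arguments.
Unset Strict Implicit.
Unset Printing Implicit Defensive.

Import Order.TTheory GRing.Theory Num.Theory.
Local Open Scope ring_scope.

(* Number fields are finite extensions of rat, i.e. [fieldExtType rat]. *)

Definition cube_sum (F : fieldExtType rat) (n : nat) : Prop :=
  exists x y : F, n%:R = x ^+ 3 + y ^+ 3.

(* [K] is a model of Q(sqrt d): it is generated over Q by a square root of d.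
   "The" field Q(sqrt d) is rendered by quantifying over its models, which
   exist for every d (is_Qsqrt_exists); a model is unique up to isomorphism. *)
Definition is_Qsqrt (K : fieldExtType rat) (d : int) : Prop :=
  exists2 r : K, r ^+ 2 = d%:~R & <<1; r>>%VS = {:K}%VS.

(* Number fields embed in the complex numbers through algC, since the image of
   any embedding consists of algebraic numbers. *)
Definition imaginary_quadratic (K : fieldExtType rat) : Prop :=
  \dim {:K} = 2%N /\
  forall f : {rmorphism K -> algC}, exists x : K, f x \isn't Num.real.

Lemma is_Qsqrt_exists (d : int) :
  exists K : fieldExtType rat, is_Qsqrt K d.
Proof.
have [K [f [s fs Ks]]] := num_field_exists [:: sqrtC (d%:~R : algC)].
case: s fs Ks => [|r [|r' s]] //= [fr] Ks.
exists K, r; last by rewrite -Ks /= adjoin_seq1.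
by apply: (fmorph_inj f); rewrite rmorphXn /= fr sqrtCK rmorph_int.
Qed.

(* Main.v *)
Require Import Defs.
From mathcomp Require Import all_boot all_order all_algebra all_field.
From mathcomp Require Import zify ring.

Import Order.TTheory GRing.Theory Num.Theory.
Local Open Scope ring_scope.

(** If [x + y = a] and [x - y = s] then [x ^+ 3 + y ^+ 3 = n] amounts to
    [a ^+ 3 + 3 * a * s ^+ 2 = 4 * n], so a rational [a] yields a solution over
    the field generated by a square root of [(4 * n - a ^+ 3) / (3 * a)].
    Write [D = 4 * n * t ^+ 3 - 27].  The choice [a = 3 / t] gives a solution
    [(x, y)] over Q(sqrt D), with [x * y = (27 - n * t ^+ 3) / (9 * t ^+ 2)].
    To pass from [D] to [- 3 * D], one follows the 3-isogeny sending [(x, y)] to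
    the triple [(- x ^+ 2 / y, - y ^+ 2 / x, n / (x * y))], which has sum 0 and
    product [n].  With [w] a primitive cube root of unity, such triples are exactly
    those of the form [w * X + w ^+ 2 * Y, w ^+ 2 * X + w * Y, X + Y] with
    [X ^+ 3 + Y ^+ 3 = n].  The resulting solution [(X, Y)] has
    [X + Y = n / (x * y) = 9 * n * t ^+ 2 / (27 - n * t ^+ 3)], and its
    difference [X - Y] is a rational multiple of a square root of [- 3 * D]
    because, with [m = n * t ^+ 3],
      [4 * (27 - m) ^+ 3 - 729 * m ^+ 2 = - (4 * m - 27) * (m + 54) ^+ 2].
    This is [cube_sum_identity].  The formula degenerates only when
    [n * t ^+ 3 = 27], which forces [n = 1], trivially a sum of two cubes.

    The field is imaginary quadratic because [- 3 * D] is negative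
    ([Qsqrt_imaginary_quadratic]). *)

Lemma cube_sum_identity (F : fieldType) (n t r : F) :
    2 != 0 :> F -> 3 != 0 :> F -> t != 0 -> 27 - n * t ^+ 3 != 0 ->
    r ^+ 2 = - 3 * (4 * n * t ^+ 3 - 27) ->
  let a := 9 * n * t ^+ 2 / (27 - n * t ^+ 3) in
  let s := r * (n * t ^+ 3 + 54) / (9 * t * (27 - n * t ^+ 3)) in
  n = ((a + s) / 2) ^+ 3 + ((a - s) / 2) ^+ 3.
Proof.
move=> nz2 nz3 nzt nzm r2 a s.
have nz9 : 9 != 0 :> F.
  by rewrite (_ : 9 = 3 * 3) ?mulf_neq0 //; ring.
have nz4 : 4 != 0 :> F.
  by rewrite (_ : 4 = 2 * 2) ?mulf_neq0 //; ring.
have s2 : s ^+ 2 = - 3 * (4 * n * t ^+ 3 - 27) * (n * t ^+ 3 + 54) ^+ 2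
                   / (9 * t * (27 - n * t ^+ 3)) ^+ 2.
  by rewrite /s -r2; field; rewrite nzm nzt nz9.
have -> : ((a + s) / 2) ^+ 3 + ((a - s) / 2) ^+ 3
          = (a ^+ 3 + 3 * a * s ^+ 2) / 4.
  by field; rewrite nz4 nz2.
by rewrite s2 /a; field; rewrite nz4 nzm nzt nz9.
Qed.

Lemma fieldExt_intr_eq0 (K : fieldExtType rat) (z : int) :
  ((z%:~R : K) == 0) = (z == 0).
Proof. by rewrite -(rmorph_int (in_alg K)) fmorph_eq0 intr_eq0. Qed.

Lemma fieldExt_natr_neq0 (K : fieldExtType rat) (m : nat) :
  (m.+1%:R : K) != 0.
Proof. by rewrite -[m.+1%:R]/(m.+1%:Z%:~R) fieldExt_intr_eq0. Qed.

(** A square root of a negative integer lies outside the prime field. *)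
Lemma sqr_neg_notin_prime (K : fieldExtType rat) (d : int) (r : K) :
  d < 0 -> r ^+ 2 = d%:~R -> r \notin 1%VS.
Proof.
move=> d_lt0 r2; apply/negP => /vlineP[q rq].
have: (in_alg K) (q ^+ 2) = (in_alg K) d%:~R.
  by rewrite rmorphXn rmorph_int /= -rq.
move/fmorph_inj => q2.
by have := sqr_ge0 q; rewrite q2 ler0z leNgt d_lt0.
Qed.

Lemma Qsqrt_imaginary_quadratic (K : fieldExtType rat) (d : int) :
  d < 0 -> is_Qsqrt K d -> imaginary_quadratic K.
Proof.
move=> d_lt0 [r r2 Kr]; split; last first.
  move=> f; exists r; apply/negP => /real_exprn_even_ge0.
  by move=> /(_ 2%N isT); rewrite -rmorphXn r2 rmorph_int ler0z leNgt d_lt0.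
rewrite -Kr dim_Fadjoin dimv1 muln1.
(* The degree of [r] is not 1, and is at most 2 since ['X^2 - d] kills [r]. *)
have deg_neq1 : adjoin_degree 1 r != 1%N.
  by rewrite adjoin_deg_eq1; exact: sqr_neg_notin_prime r2.
have pol : ('X^2 - (d%:~R : K)%:P) \is a polyOver 1%VS.
  by rewrite rpredB ?rpredX ?polyOverX // polyOverC rpred_int.
have rt : root ('X^2 - (d%:~R : K)%:P) r.
  by rewrite /root !hornerE r2 subrr.
have := dvdp_leq _ (minPoly_dvdp pol rt).
rewrite -size_poly_eq0 size_XnsubC // size_minPoly => /(_ isT).
by move: deg_neq1; rewrite /adjoin_degree; case: (_.-1) => [|[]].
Qed.

Theorem proposition1p18 (n : nat) (hn : (0 < n)%N) (t : int) (ht : 3 <= t)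
    (K : fieldExtType rat)
    (hK : is_Qsqrt K (- 3 * (4 * n%:Z * t ^+ 3 - 27))) :
  imaginary_quadratic K /\ cube_sum K n.
Proof.
have t3 : 27 <= t ^+ 3 by nia.
split.
  apply: Qsqrt_imaginary_quadratic hK.
  have : 27 <= n%:Z * t ^+ 3 by nia.
  by rewrite -mulrA; lia.
have [m27|m27] := eqVneq (n%:Z * t ^+ 3) 27.
  (* Here [n * t ^+ 3 = 27 <= t ^+ 3] leaves only [n = 1] and [t = 3]. *)
  have -> : n = 1%N by nia.
  by exists 1, 0; rewrite expr1n expr0n addr0.
case: hK => r r2 _.
have nzt : (t%:~R : K) != 0 by rewrite fieldExt_intr_eq0; lia.
have nzm : 27 - n%:R * t%:~R ^+ 3 != 0 :> K.
  have -> : 27 - n%:R * t%:~R ^+ 3 = (27 - n%:Z * t ^+ 3)%:~R :> K.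
    by rewrite rmorphB rmorphM rmorphXn.
  by rewrite fieldExt_intr_eq0 subr_eq0 eq_sym.
have r2K : r ^+ 2 = - 3 * (4 * n%:R * t%:~R ^+ 3 - 27).
  by rewrite r2 intrM rmorphN rmorphB /=
             (intrM _ (4 * n%:Z)) (intrM _ 4) rmorphXn.
by do 2 eexists; apply: cube_sum_identity r2K;
  rewrite ?fieldExt_natr_neq0.
Qed.
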